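(* For all integers $1 \le k \le n$, let $lt_{\alpha}$ denote the number of standard lexical tableaux of shape $\alpha$. Then \[ \sum_{\substack{ \alpha \vDash n,\\ \ell(\alpha)=k}} lt_{\alpha} = {n \brack k}, \] where ${n \brack k}$ is the unsigned Stirling number of the first kind, i.e. the number of permutations of $\{1,\dots,n\}$ having exactly $k$ disjoint cycles.
   Context: A composition $\alpha \vDash n$ is a finite tuple of positive integers $(\alpha_1,\dots,\alpha_{\ell(\alpha)})$ summing to $n$. Its diagram has left-justified rows, row $i$ (counted from the bottom) having $\alpha_i$ cells. For a word $w=w_1\cdots w_m$ over a totally ordered alphabet, its cyclic shifts are $w_{i+1}\cdots w_m w_1\cdots w_i$ for $i\in\{1,\dots,m\}$; $w$ is a necklace word if it is lexicographically smallest (weakly) among all its cyclic shifts. A lexical tableau of shape $\alpha$ and type (content) $\beta$ is a filling of the diagram of $\alpha$ with positive integers such that the integer $i$ appears exactly $\beta_i$ times, the entries of the first column strictly increase from row $1$ upward, and for each $i$ the word formed by the entries of row $i$ read left to right is a necklace word. A lexical tableau is standard if its type is $(1,1,\dots,1)=(1^n)$, i.e. it uses each of $1,\dots,n$ exactly once. *)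

(* Defs.v *)
From HB Require Import structures.
From mathcomp Require Import all_boot all_order all_fingroup.

Set Implicit Arguments.
Unset Strict Implicit.
Unset Printing Implicit Defensive.

Definition is_composition (n : nat) (alpha : seq nat) : bool :=
  all (ltn 0) alpha && (sumn alpha == n).

(* Rows and columns are numbered from 0; row 0 is the bottom row. *)
Definition diagram (alpha : seq nat) : finType :=
  {i : 'I_(size alpha) & 'I_(nth 0 alpha i)}.

Definition cell (alpha : seq nat) (i : 'I_(size alpha))
    (j : 'I_(nth 0 alpha i)) : diagram alpha :=
  Tagged (fun i : 'I_(size alpha) => 'I_(nth 0 alpha i)) j.

Definition cell_row (alpha : seq nat) (c : diagram alpha) : nat := tag c.

Definition cell_col (alpha : seq nat) (c : diagram alpha) : nat := tagged c.

Definition row_word (alpha : seq nat) (T : diagram alpha -> nat)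
    (i : 'I_(size alpha)) : seq nat :=
  [seq T (cell j) | j <- enum 'I_(nth 0 alpha i)].

(* [rot i w] is the cyclic shift w_{i+1} ... w_m w_1 ... w_i; [seqlexi] is
   [seq] with the lexicographic order. *)
Definition necklace (d : Order.disp_t) (A : orderType d) (w : seq A) : bool :=
  all (fun i => ((w : seqlexi A) <= (rot i w : seqlexi A))%O)
      (iota 1 (size w)).

(* beta_i is [nth 0 beta i.-1], hence 0 for i > size beta; [has_typeP] is the
   unbounded form of the definition. *)
Definition has_type (alpha beta : seq nat) (T : diagram alpha -> nat) : bool :=
  [forall c, 0 < T c <= size beta] &&
  [forall i : 'I_(size beta), #|[set c | T c == i.+1]| == nth 0 beta i].

Lemma has_typeP (alpha beta : seq nat) (T : diagram alpha -> nat) :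
  reflect ((forall c, 0 < T c) /\
           (forall i, 0 < i -> #|[set c | T c == i]| = nth 0 beta i.-1))
          (has_type beta T).
Proof.
apply: (iffP andP) => [[/forallP T_bd /forallP T_ct]|[T_gt0 T_ct]].
  split=> [c|[//|i] _ /=]; first by case/andP: (T_bd c).
  have [lt_i|le_i] := ltnP i (size beta); first exact/eqP/(T_ct (Ordinal lt_i)).
  rewrite nth_default //; apply/eqP; rewrite cards_eq0; apply/eqP/setP=> c.
  rewrite !inE; apply/eqP=> Tc; case/andP: (T_bd c) => _.
  by rewrite Tc ltnNge le_i.
split; apply/forallP; last by move=> i; rewrite T_ct.
move=> c; rewrite T_gt0 leqNgt; apply/negP=> lt_c.
have := T_ct (T c) (T_gt0 c); rewrite nth_default; last first.
  by move: lt_c; case: (T c).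
move/eqP; rewrite cards_eq0 => /eqP/setP/(_ c).
by rewrite !inE eqxx.
Qed.

Definition first_col_increasing (alpha : seq nat) (T : diagram alpha -> nat) :
    bool :=
  [forall c, forall c',
    [&& cell_col c == 0, cell_col c' == 0 & cell_row c < cell_row c']
      ==> (T c < T c')].

Definition lexical_tableau (alpha beta : seq nat) (T : diagram alpha -> nat) :
    bool :=
  [&& has_type beta T,
      first_col_increasing T &
      [forall i : 'I_(size alpha), necklace (row_word T i)]].

Definition standard_lexical_tableau (alpha : seq nat)
    (T : diagram alpha -> nat) : bool :=
  lexical_tableau (nseq (sumn alpha) 1) T.

(* Every standard lexical tableau has entries in {1, ..., n} with
   n = sumn alpha, so counting fillings with values in 'I_n.+1 loses none. *)
Definition num_standard_lt (alpha : seq nat) : nat :=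
  #|[set T : {ffun diagram alpha -> 'I_(sumn alpha).+1} |
      standard_lexical_tableau (fun c => T c : nat)]|.

(* [porbits s] is the set of cycles of s, fixed points included. *)
Definition stirling1 (n k : nat) : nat :=
  #|[set s : 'S_n | #|porbits s| == k]|.

(* Main.v *)
Require Import Defs.
From mathcomp Require Import all_boot all_order all_fingroup.

Set Implicit Arguments.
Unset Strict Implicit.
Unset Printing Implicit Defensive.

Import Order.TTheory.

(** A word without repetition is a necklace word exactly when its first letter
is its minimum.  The rows of a standard lexical tableau are therefore the
cycles of a permutation, each written from its minimum, and listed by
increasing minimum; in other words, the tableau conjugates the rotation of the
rows of its diagram into that permutation.  This presentation of a permutation
is unique, so the standard lexical tableaux of shape [alpha] are in bijection
with the permutations whose list of cycle lengths, taken in that order, is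
[alpha]; summing over [alpha] counts the permutations with [k] cycles. *)

Lemma iter_mod_porbit (X : finType) (s : {perm X}) x i :
  iter (i %% #|porbit s x|) s x = iter i s x.
Proof.
rewrite [in RHS](divn_eq i #|porbit s x|) addnC iterD iterM.
by rewrite (iter_fix _ (iter_porbit s x)).
Qed.

Lemma sum_card_porbits (X : finType) (s : {perm X}) :
  \sum_(P in porbits s) #|P| = #|X|.
Proof.
rewrite -[RHS]sum1_card.
rewrite (partition_big (porbit s) (mem (porbits s))) /=; last first.
  by move=> x _; apply: imset_f.
apply: eq_bigr => _ /imsetP[x _ ->]; rewrite -sum1_card.
by apply: eq_bigl => y; rewrite eq_porbit_mem.
Qed.

Section Intertwining.

Variables (C X : finType) (r : {perm C}).

Lemma bij_conj_perm (f : C -> X) :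
  bijective f -> exists s : {perm X}, {morph f : c / r c >-> s c}.
Proof.
case=> g fK gK; have s_inj : injective (f \o r \o g).
  exact: inj_comp (inj_comp (can_inj fK) perm_inj) (can_inj gK).
by exists (perm s_inj) => c; rewrite permE /= fK.
Qed.

Variables (s : {perm X}) (f : C -> X).
Hypothesis f_morph : {morph f : c / r c >-> s c}.

Lemma iter_perm_morph i : {morph f : c / iter i r c >-> iter i s c}.
Proof. by move=> c; elim: i => //= i <-. Qed.

Lemma porbit_morph c : porbit s (f c) = f @: porbit r c.
Proof.
apply/setP=> x; apply/porbitP/imsetP => [[i ->]|[_ /porbitP[i ->] ->]].
  by exists ((r ^+ i)%g c); rewrite ?mem_porbit // !permX iter_perm_morph.
by exists i; rewrite !permX iter_perm_morph.
Qed.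

End Intertwining.

Section CycleMinima.

Variables (disp : Order.disp_t) (X : finOrderType disp) (s : {perm X}).
Implicit Types x y : X.

Definition cycle_min x : bool := [forall y in porbit s x, x <= y]%O.

Definition cycle_minima : seq X := sort <=%O (enum cycle_min).

Definition cycle_shape : seq nat := [seq #|porbit s x| | x <- cycle_minima].

Lemma mem_cycle_minima x : (x \in cycle_minima) = cycle_min x.
Proof. by rewrite mem_sort mem_enum. Qed.

Lemma cycle_minima_sorted : sorted <%O cycle_minima.
Proof. by rewrite sort_lt_sorted enum_uniq. Qed.

Lemma cycle_min_inj : {in cycle_min &, injective (porbit s)}.
Proof.
move=> x y /forall_inP minx /forall_inP miny Exy; apply/le_anti.
by rewrite minx ?miny // ?Exy ?porbit_id // -Exy porbit_id.
Qed.

Lemma cycle_min_exists x : exists2 y, cycle_min y & x \in porbit s y.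
Proof.
case: (arg_minP id (porbit_id s x)) => y yx miny.
have /eqP Eyx: porbit s y == porbit s x by rewrite eq_porbit_mem.
exists y; last by rewrite porbit_sym.
by apply/forall_inP=> z; rewrite Eyx; apply: miny.
Qed.

Lemma imset_cycle_min : porbit s @: cycle_min = porbits s.
Proof.
apply/setP=> P; apply/imsetP/imsetP=> [[x _ ->]|[x _ ->]]; first by exists x.
have [y miny xy] := cycle_min_exists x.
by exists y => //; apply/eqP; rewrite eq_porbit_mem.
Qed.

Lemma size_cycle_minima : size cycle_minima = size cycle_shape.
Proof. by rewrite size_map. Qed.

Lemma size_cycle_shape : size cycle_shape = #|porbits s|.
Proof.
rewrite size_map size_sort -cardE -imset_cycle_min.
by rewrite (card_in_imset cycle_min_inj).
Qed.

Lemma sumn_cycle_shape : sumn cycle_shape = #|X|.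
Proof.
rewrite sumnE big_map (perm_big _ (permEl (perm_sort _ _))) big_enum /=.
rewrite -(big_imset (fun P : {set X} => #|P|) cycle_min_inj) imset_cycle_min.
exact: sum_card_porbits.
Qed.

Lemma cycle_shape_composition : is_composition #|X| cycle_shape.
Proof.
rewrite /is_composition sumn_cycle_shape eqxx andbT all_map.
by apply/allP=> x _ /=; rewrite lt0n card_porbit_neq0.
Qed.

End CycleMinima.

Lemma necklace_uniqP (disp : Order.disp_t) (A : orderType disp) (x0 : A)
    (w : seq A) :
  uniq w -> reflect {in w, forall y, (head x0 w <= y)%O} (necklace w).
Proof.
case: w => [|x w] Uw; first by constructor.
apply: (iffP allP) => [neck y yw|minx i].
  have [->|neq_xy] := eqVneq y x; first by [].
  have := neck (index y (x :: w)).
  rewrite mem_iota add1n ltnS index_size andbT lt0n.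
  have [|_ /(_ isT)] := eqVneq (index y (x :: w)) 0.
    by rewrite /= eq_sym (negPf neq_xy).
  rewrite /rot (drop_nth x0) ?index_mem // nth_index //= lexi_cons.
  by case/andP.
rewrite mem_iota add1n ltnS => /andP[i_gt0].
rewrite leq_eqVlt => /predU1P[->|lti]; first by rewrite rot_size.
have neq_x : x != nth x0 (x :: w) i.
  by rewrite -[X in X != _]/(nth x0 (x :: w) 0) nth_uniq // eq_sym -lt0n.
rewrite /rot (drop_nth x0) //= neqhead_lexiE // lt_neqAle neq_x.
by apply: minx; apply: mem_nth.
Qed.

Section Diagram.

Variable alpha : seq nat.
Implicit Types c d : diagram alpha.

Lemma cell_row_lt c : cell_row c < size alpha.
Proof. exact: ltn_ord. Qed.

Lemma cell_col_lt c : cell_col c < nth 0 alpha (cell_row c).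
Proof. exact: ltn_ord. Qed.

Lemma cell_eq c d : cell_row c = cell_row d -> cell_col c = cell_col d -> c = d.
Proof.
case: c d => [i j] [i' j']; rewrite /cell_row /cell_col /= => /val_inj Ei.
by case: i' / Ei j' => j' /val_inj ->.
Qed.

Lemma cell_inj i : injective (@cell alpha i).
Proof. by move=> j j' /(congr1 (@cell_col alpha))/val_inj. Qed.

Lemma map_nth_enum_ord :
  [seq nth 0 alpha (i : 'I_(size alpha)) | i <- enum 'I_(size alpha)] = alpha.
Proof.
by rewrite (map_comp (nth 0 alpha) val) val_enum_ord map_nth_iota0 ?take_size.
Qed.

Lemma card_diagram : #|diagram alpha| = sumn alpha.
Proof.
rewrite card_tagged -[in RHS]map_nth_enum_ord; congr sumn.
by apply: eq_map => i; apply: card_ord.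
Qed.

Lemma card_row (i : 'I_(size alpha)) :
  #|[set c : diagram alpha | cell_row c == i]| = nth 0 alpha i.
Proof.
rewrite -[RHS]card_ord -(card_imset _ (@cell_inj i)); apply: eq_card => c.
rewrite inE; apply/eqP/imsetP=> [Er|[j _ ->] //].
have ltj : cell_col c < nth 0 alpha i by rewrite -Er cell_col_lt.
by exists (Ordinal ltj) => //; apply: cell_eq.
Qed.

Definition next_in_row c : diagram alpha := cell (ordS (tagged c)).

Lemma next_in_row_inj : injective next_in_row.
Proof.
move=> [i j] [i' j'] E.
have /val_inj Ei : i = i' :> nat := congr1 (@cell_row alpha) E.
case: i' / Ei j' E => j' /(congr1 (@cell_col alpha)) Ej.
by congr Tagged; apply/ordS_inj/val_inj.
Qed.

Definition row_rotation : {perm diagram alpha} := perm next_in_row_inj.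

Lemma cell_row_rotation c : cell_row (row_rotation c) = cell_row c.
Proof. by rewrite permE. Qed.

Lemma cell_col_rotation c :
  cell_col (row_rotation c) = (cell_col c).+1 %% nth 0 alpha (cell_row c).
Proof. by rewrite permE. Qed.

Lemma cell_row_iter_rotation i c :
  cell_row (iter i row_rotation c) = cell_row c.
Proof. by elim: i => //= i <-; rewrite cell_row_rotation. Qed.

Lemma cell_col_iter_rotation i c :
  cell_col (iter i row_rotation c) =
    (cell_col c + i) %% nth 0 alpha (cell_row c).
Proof.
elim: i => [|i IHi] /=; first by rewrite addn0 modn_small ?cell_col_lt.
rewrite cell_col_rotation cell_row_iter_rotation IHi.
by rewrite -addn1 modnDml addn1 addnS.
Qed.

Lemma porbit_row_rotation c :
  porbit row_rotation c = [set d | cell_row d == cell_row c].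
Proof.
apply/setP=> d; rewrite inE; apply/porbitP/eqP=> [[i ->]|Er].
  by rewrite permX cell_row_iter_rotation.
exists (nth 0 alpha (cell_row c) - cell_col c + cell_col d); rewrite permX.
apply: cell_eq; first by rewrite cell_row_iter_rotation.
rewrite cell_col_iter_rotation addnA subnKC; last exact/ltnW/cell_col_lt.
by rewrite modnDl modn_small // -Er cell_col_lt.
Qed.

Section InjectiveIntertwining.

Variables (X : finType) (f : diagram alpha -> X) (s : {perm X}).
Hypotheses (f_inj : injective f)
  (f_morph : {morph f : c / row_rotation c >-> s c}).

Lemma mem_porbit_row_morph c d :
  (f d \in porbit s (f c)) = (cell_row d == cell_row c).
Proof.
by rewrite (porbit_morph f_morph) mem_imset // porbit_row_rotation inE.
Qed.

Lemma card_porbit_row_morph c : #|porbit s (f c)| = nth 0 alpha (cell_row c).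
Proof.
by rewrite (porbit_morph f_morph) card_imset // porbit_row_rotation card_row.
Qed.

End InjectiveIntertwining.

End Diagram.

Section CycleEntry.

Variables (alpha : seq nat) (disp : Order.disp_t) (X : finOrderType disp).
Variable x0 : X.
Implicit Types (c : diagram alpha) (s t : {perm X}).

Definition cycle_entry s c : X :=
  iter (cell_col c) s (nth x0 (cycle_minima s) (cell_row c)).

Section CyclesOfShape.

Variable s : {perm X}.
Hypothesis shape_s : cycle_shape s = alpha.

Lemma cycle_min_nth (i : 'I_(size alpha)) :
  cycle_min s (nth x0 (cycle_minima s) i).
Proof.
by rewrite -mem_cycle_minima mem_nth // size_cycle_minima shape_s.
Qed.

Lemma card_porbit_nth (i : 'I_(size alpha)) :
  #|porbit s (nth x0 (cycle_minima s) i)| = nth 0 alpha i.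
Proof.
rewrite -(congr1 (nth 0 ^~ i) shape_s) (nth_map x0) // size_cycle_minima.
by rewrite shape_s.
Qed.

Lemma cycle_entry_morph :
  {morph cycle_entry s : c / row_rotation alpha c >-> s c}.
Proof.
move=> c; rewrite /cycle_entry cell_row_rotation cell_col_rotation.
by rewrite -card_porbit_nth iter_mod_porbit.
Qed.

Lemma cycle_entry_surj x : exists c, cycle_entry s c = x.
Proof.
have [y] := cycle_min_exists s x.
rewrite -mem_cycle_minima => /(nthP x0)[i lti <-].
rewrite size_cycle_minima shape_s in lti; pose i' := Ordinal lti.
rewrite porbit_traject (card_porbit_nth i') => /trajectP[j ltj ->].
by exists (@cell alpha i' (Ordinal ltj)).
Qed.

Lemma cycle_entry_inj : injective (cycle_entry s).
Proof.
apply: in2T; apply/imset_injP.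
have -> : cycle_entry s @: predT = [set: X].
  apply/setP=> x; rewrite inE; have [c <-] := cycle_entry_surj x.
  by rewrite imset_f.
by rewrite cardsT card_diagram -shape_s sumn_cycle_shape.
Qed.

End CyclesOfShape.

Lemma cycle_entry_perm_inj s t :
  cycle_shape s = alpha -> cycle_shape t = alpha ->
  cycle_entry s =1 cycle_entry t -> s = t.
Proof.
move=> shs sht Est; apply/permP=> x; have [c <-] := cycle_entry_surj shs x.
by rewrite -cycle_entry_morph // !Est cycle_entry_morph.
Qed.

End CycleEntry.

Section LexicalLabelling.

Variable alpha : seq nat.
Hypothesis alpha_gt0 : all (ltn 0) alpha.
Implicit Types c d : diagram alpha.

Lemma row_length_gt0 (i : 'I_(size alpha)) : 0 < nth 0 alpha i.
Proof. exact: (all_nthP 0 alpha_gt0). Qed.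

Definition row_head (i : 'I_(size alpha)) : diagram alpha :=
  cell (Ordinal (row_length_gt0 i)).

Lemma cell_col_eq0 c : cell_col c = 0 -> c = row_head (tag c).
Proof. by move=> c0; apply: cell_eq. Qed.

Lemma iter_rotation_row_head c :
  iter (cell_col c) (row_rotation alpha) (row_head (tag c)) = c.
Proof.
apply: cell_eq; first by rewrite cell_row_iter_rotation.
by rewrite cell_col_iter_rotation modn_small // cell_col_lt.
Qed.

Variables (disp : Order.disp_t) (X : finOrderType disp).
Implicit Types (f : diagram alpha -> X) (s : {perm X}).

Definition lexical_labelling f : Prop :=
  [/\ injective f,
      {homo f \o row_head : i j / (i < j)%O}
    & forall c, (f (row_head (tag c)) <= f c)%O].

Lemma cycle_minima_labelling f s :
  #|X| <= sumn alpha -> lexical_labelling f ->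
  {morph f : c / row_rotation alpha c >-> s c} ->
  cycle_minima s = [seq f (row_head i) | i <- enum 'I_(size alpha)].
Proof.
move=> le_X [f_inj f_col f_row] f_morph.
have [|g fK gK] := inj_card_bij f_inj; first by rewrite card_diagram.
apply: lt_sorted_eq; first exact: cycle_minima_sorted.
  apply: homo_sorted f_col _ _.
  by rewrite -(sorted_map (f := val) (e' := ltn)) val_enum_ord iota_ltn_sorted.
move=> x; rewrite mem_cycle_minima; apply/forall_inP/mapP=> [|[i _ ->] y].
  rewrite -[x]gK; move: (g x) => c minc.
  exists (tag c); first by rewrite mem_enum.
  by apply/le_anti; rewrite f_row minc // (mem_porbit_row_morph f_inj f_morph).
rewrite -[y]gK (mem_porbit_row_morph f_inj f_morph) => /eqP/val_inj/= <-.
exact: f_row.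
Qed.

Lemma cycle_shape_labelling f s :
  #|X| <= sumn alpha -> lexical_labelling f ->
  {morph f : c / row_rotation alpha c >-> s c} -> cycle_shape s = alpha.
Proof.
move=> le_X f_lex f_morph; have [f_inj _ _] := f_lex.
rewrite /cycle_shape (cycle_minima_labelling le_X f_lex f_morph) -map_comp.
rewrite -[RHS]map_nth_enum_ord; apply: eq_map => i.
exact: card_porbit_row_morph f_inj f_morph (row_head i).
Qed.

Lemma lexical_labelling_cycle_entry x0 f :
  #|X| <= sumn alpha -> lexical_labelling f ->
  exists2 s, cycle_shape s = alpha & f =1 cycle_entry x0 s.
Proof.
move=> le_X f_lex; have [f_inj _ _] := f_lex.
have f_bij : bijective f by apply: inj_card_bij => //; rewrite card_diagram.
have [s f_morph] := bij_conj_perm (row_rotation alpha) f_bij.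
exists s => [|c]; first exact: cycle_shape_labelling le_X f_lex f_morph.
rewrite -[in LHS](iter_rotation_row_head c) (iter_perm_morph f_morph).
rewrite /cycle_entry (cycle_minima_labelling le_X f_lex f_morph).
by rewrite (nth_map (tag c)) ?size_enum_ord ?cell_row_lt // nth_ord_enum.
Qed.

Lemma cycle_entry_lexical x0 s :
  cycle_shape s = alpha -> lexical_labelling (cycle_entry x0 s).
Proof.
move=> shape_s; split=> [|i j ltij /=|c]; first exact: cycle_entry_inj.
  apply: (sorted_ltn_nth lt_trans x0 (cycle_minima_sorted s)) => //.
    by rewrite inE size_cycle_minima shape_s cell_row_lt.
  by rewrite inE size_cycle_minima shape_s cell_row_lt.
apply: (forall_inP (cycle_min_nth x0 shape_s (tag c))).
by rewrite /cycle_entry -permX mem_porbit.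
Qed.

End LexicalLabelling.

Section StandardTableaux.

Variable alpha : seq nat.
Implicit Type T : diagram alpha -> nat.

Lemma has_standard_typeP T :
  reflect (exists2 f : diagram alpha -> 'I_(sumn alpha),
             injective f & T =1 (fun c => (f c).+1))
          (has_type (nseq (sumn alpha) 1) T).
Proof.
apply: (iffP andP); rewrite size_nseq => -[].
  move=> /forallP T_bd /forallP T_ct.
  have ltT c : (T c).-1 < sumn alpha by case/andP: (T_bd c) => /prednK ->.
  have T_pred c : T c = (T c).-1.+1 by case/andP: (T_bd c) => /prednK.
  exists (fun c => Ordinal (ltT c)) => // c d [Ecd].
  have := T_ct (Ordinal (ltT c)).
  rewrite nth_nseq ltT => /cards1P[e Ee].
  have /set1P -> : c \in [set e] by rewrite -Ee inE /= -T_pred.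
  by have /set1P -> : d \in [set e] by rewrite -Ee inE /= Ecd -T_pred.
move=> f f_inj Tf; split; apply/forallP; first by move=> c; rewrite Tf ltn_ord.
move=> i; have [|g fK gK] := inj_card_bij f_inj.
  by rewrite card_ord card_diagram.
rewrite nth_nseq ltn_ord; apply/cards1P; exists (g i); apply/setP=> c.
by rewrite !inE Tf eqSS -(inj_eq f_inj) gK.
Qed.

Hypothesis alpha_gt0 : all (ltn 0) alpha.
Local Notation row_head := (row_head alpha_gt0).

Lemma first_col_increasingP T :
  reflect {homo T \o row_head : i j / i < j} (first_col_increasing T).
Proof.
apply: (iffP 'forall_forallP) => [T_col i j ltij | T_col c d].
  exact: (implyP (T_col (row_head i) (row_head j))).
apply/implyP=> /and3P[/eqP/(cell_col_eq0 alpha_gt0) ->].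
by move=> /eqP/(cell_col_eq0 alpha_gt0) -> ltr; apply: T_col.
Qed.

Lemma head_row_word T i : head 0 (row_word T i) = T (row_head i).
Proof.
pose j0 := Ordinal (row_length_gt0 alpha_gt0 i).
rewrite -nth0 /row_word (nth_map j0) ?size_enum_ord ?row_length_gt0 //.
by congr (T (cell _)); apply: (nth_ord_enum j0 j0).
Qed.

Lemma necklace_rowsP T : injective T ->
  reflect (forall c, T (row_head (tag c)) <= T c)
          [forall i : 'I_(size alpha), necklace (row_word T i)].
Proof.
move=> T_inj; have row_uniq i : uniq (row_word T i).
  by rewrite map_inj_uniq ?enum_uniq // => j j' /T_inj/cell_inj.
apply: (iffP forallP) => [neck [i j] | T_row i].
  rewrite -head_row_word -leEnat.
  by apply: (necklace_uniqP 0 (row_uniq i) (neck i)); rewrite map_f ?mem_enum.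
apply/(necklace_uniqP 0 (row_uniq i)) => _ /mapP[j _ ->].
by rewrite head_row_word; apply: T_row.
Qed.

Lemma standard_lexical_tableauP T :
  reflect (exists2 f : diagram alpha -> 'I_(sumn alpha),
             lexical_labelling alpha_gt0 f & T =1 (fun c => (f c).+1))
          (standard_lexical_tableau T).
Proof.
apply: (iffP and3P) => [[/has_standard_typeP[f f_inj Tf]]|].
  have T_inj : injective T by move=> c d; rewrite !Tf => -[] /val_inj/f_inj.
  move=> /first_col_increasingP T_col /(necklace_rowsP T_inj) T_row.
  exists f => //; split=> // [i j /T_col|c]; first by rewrite /= !Tf.
  by have := T_row c; rewrite !Tf.
case=> f [f_inj f_col f_row] Tf; split.
- by apply/has_standard_typeP; exists f.
- by apply/first_col_increasingP=> i j /f_col; rewrite /= !Tf.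
apply/necklace_rowsP=> [c d|c]; first by rewrite !Tf => -[] /val_inj/f_inj.
by rewrite !Tf; apply: f_row.
Qed.

Variable x0 : 'I_(sumn alpha).

Definition cycle_tableau (s : 'S_(sumn alpha)) :
    {ffun diagram alpha -> 'I_(sumn alpha).+1} :=
  [ffun c => lift ord0 (cycle_entry x0 s c)].

Lemma cycle_tableau_inj :
  {in [set s | cycle_shape s == alpha] &, injective cycle_tableau}.
Proof.
move=> s t; rewrite !inE => /eqP shs /eqP sht /ffunP Est.
apply: (cycle_entry_perm_inj (x0 := x0) shs sht) => c.
by have := Est c; rewrite !ffunE => /lift_inj.
Qed.

Lemma imset_cycle_tableau :
  cycle_tableau @: [set s | cycle_shape s == alpha] =
  [set T : {ffun diagram alpha -> 'I_(sumn alpha).+1} |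
    standard_lexical_tableau (fun c => T c : nat)].
Proof.
apply/setP=> T; rewrite inE.
apply/imsetP/standard_lexical_tableauP => [[s]|[f f_lex Tf]].
  rewrite inE => /eqP shs ->; exists (cycle_entry x0 s).
    exact: cycle_entry_lexical.
  by move=> c; rewrite ffunE lift0.
have [|s shs fE] := lexical_labelling_cycle_entry x0 _ f_lex.
  by rewrite card_ord.
exists s; first by rewrite inE shs.
by apply/ffunP=> c; apply/val_inj; rewrite ffunE /= Tf fE.
Qed.

End StandardTableaux.

Lemma num_standard_lt_cycle_shape n alpha : 0 < n -> is_composition n alpha ->
  num_standard_lt alpha = #|[set s : 'S_n | cycle_shape s == alpha]|.
Proof.
move=> n_gt0 /andP[alpha_gt0 /eqP En]; case: n / En n_gt0 => n_gt0.
rewrite -(card_in_imset (cycle_tableau_inj (x0 := Ordinal n_gt0))).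
by rewrite imset_cycle_tableau.
Qed.

Lemma leq_sumn (a : seq nat) m : m \in a -> m <= sumn a.
Proof. by move=> am; rewrite sumnE (big_rem m) ?leq_addr. Qed.

Section CompositionTuples.

Variables n k : nat.

Definition tuple_parts (alpha : k.-tuple 'I_n.+1) : seq nat :=
  map (@nat_of_ord n.+1) alpha.

Lemma tuple_parts_inj : injective tuple_parts.
Proof. by move=> alpha beta /(inj_map val_inj)/val_inj. Qed.

Definition composition_tuple (a : seq nat) : k.-tuple 'I_n.+1 :=
  [tuple inord (nth 0 a i) | i < k].

Lemma composition_tupleK (a : seq nat) :
  is_composition n a -> size a = k -> tuple_parts (composition_tuple a) = a.
Proof.
move=> /andP[_ /eqP sum_a] size_a.
apply: (@eq_from_nth _ 0) => [|i]; rewrite size_map size_tuple // => lti.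
rewrite (nth_map ord0) ?size_tuple // (nth_mktuple _ _ (Ordinal lti)) inordK //.
by rewrite ltnS -sum_a leq_sumn ?mem_nth ?size_a.
Qed.

Lemma sum_card_composition (S : finType) (shape : S -> seq nat) :
  (forall s, is_composition n (shape s)) ->
  \sum_(alpha : k.-tuple 'I_n.+1 | is_composition n (tuple_parts alpha))
     #|[set s | shape s == tuple_parts alpha]| =
  #|[set s | size (shape s) == k]|.
Proof.
move=> shape_comp; rewrite -[RHS]sum1_card.
rewrite (partition_big (composition_tuple \o shape)
  (fun alpha => is_composition n (tuple_parts alpha))) /= => [|s]; last first.
  by rewrite inE => /eqP size_s; rewrite composition_tupleK.
apply: eq_bigr => alpha alpha_comp; rewrite -sum1_card; apply: eq_bigl => s.
rewrite !inE; apply/eqP/andP=> [shape_s|[/eqP size_s /eqP <-]].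
  have size_s : size (shape s) = k by rewrite shape_s size_map size_tuple.
  by rewrite size_s -(inj_eq tuple_parts_inj) composition_tupleK // shape_s.
by rewrite composition_tupleK.
Qed.

End CompositionTuples.

(* A composition of n has all its parts at most n, so it is a tuple over
   'I_n.+1. *)
Theorem theorem3p3 (n k : nat) (hk : 1 <= k) (hkn : k <= n) :
  \sum_(alpha : k.-tuple 'I_n.+1 | is_composition n (map (@nat_of_ord n.+1) alpha))
     num_standard_lt (map (@nat_of_ord n.+1) alpha) = stirling1 n k.
Proof.
have n_gt0 : 0 < n := leq_trans hk hkn.
have shape_comp (s : 'S_n) : is_composition n (cycle_shape s).
  by have := cycle_shape_composition s; rewrite card_ord.
rewrite (eq_bigr _ (fun alpha => num_standard_lt_cycle_shape n_gt0)).
rewrite (sum_card_composition k shape_comp).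
by apply: eq_card => s; rewrite !inE size_cycle_shape.
Qed.
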